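(* Let $B=\bigoplus_{\alpha\in\mathbb{Z}}\mathbb{C}[\partial]L_\alpha(w)$ be the free $\mathbb{C}[\partial]$-module with basis $\{L_\alpha(w)\mid \alpha\in\mathbb{Z}\}$. Define a $\lambda$-bracket on the basis by $$[L_\alpha(w)_\lambda L_\beta(w)]=(\alpha\partial+(\alpha+\beta)\lambda)L_{\alpha+\beta}(w)\qquad(\alpha,\beta\in\mathbb{Z}),$$ and extend it to a $\mathbb{C}$-bilinear bracket $B\times B\to \mathbb{C}[\lambda]\otimes B$ by the rules $[\partial a_\lambda b]=-\lambda[a_\lambda b]$ and $[a_\lambda\partial b]=(\partial+\lambda)[a_\lambda b]$. Then $B$, with this bracket, is a Lie conformal algebra.
   Context: A Lie conformal algebra is a left $\mathbb{C}[\partial]$-module $R$ endowed with a $\lambda$-bracket $[a_\lambda b]$ defining a ($\mathbb{C}$-)linear map $R\otimes R\to R[\lambda]=\mathbb{C}[\lambda]\otimes R$ such that for all $a,b,c\in R$: (conformal sesquilinearity) $[\partial a_\lambda b]=-\lambda[a_\lambda b]$ and $[a_\lambda\partial b]=(\partial+\lambda)[a_\lambda b]$; (skew symmetry) $[b_\lambda a]=-[a_{-\partial-\lambda}b]$, where the right side means: substitute $-\partial-\lambda$ for the variable of the bracket $[a_\lambda b]$, with $\partial$ acting on the coefficients in $R$; (Jacobi identity) $[[a_\lambda b]_{\lambda+\mu}c]=[a_\lambda[b_\mu c]]-[b_\mu[a_\lambda c]]$. Here $L_\alpha(w)$ is just a name for a basis element. *)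

(* Defs.v *)
From HB Require Import structures.
From mathcomp Require Import all_boot all_order all_algebra.
From mathcomp Require Import finmap monalg.
From mathcomp.real_closed Require Import complex.
From mathcomp Require Import reals.

Set Implicit Arguments.
Unset Strict Implicit.
Unset Printing Implicit Defensive.

Import GRing.Theory.
Local Open Scope ring_scope.

(* For an additive group M and a choiceType K of exponents, {malg M[K]} is the
   group of finitely supported families K -> M, and << v *g k >> is the family
   with value v at k and 0 elsewhere.  Thus {malg M[nat]} is M[lambda], where
   << v *g n >> is lambda^n v. *)

(* M[lambda, mu], where << v *g (m, n) >> is lambda^m mu^n v. *)
Notation poly2 M := {malg M[(nat * nat)%type]}.

Section PolynomialsWithModuleCoefficients.

Variables (k : fieldType) (M : lmodType {poly k}).

(* Coefficientwise action of q : k[partial]. *)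
Definition coef_scale (q : {poly k}) (p : {malg M[nat]}) : {malg M[nat]} :=
  \sum_(n <- msupp p) << q *: p@_n *g n >>.

Definition coef_partial : {malg M[nat]} -> {malg M[nat]} := coef_scale 'X.

Definition mul_lambda (p : {malg M[nat]}) : {malg M[nat]} :=
  \sum_(n <- msupp p) << p@_n *g n.+1 >>.

Definition mul_lambda2 (p : poly2 M) : poly2 M :=
  \sum_(e <- msupp p) << p@_e *g (e.1.+1, e.2) >>.

Definition mul_mu2 (p : poly2 M) : poly2 M :=
  \sum_(e <- msupp p) << p@_e *g (e.1, e.2.+1) >>.

(* For p = \sum_n lambda^n p_n, the sum \sum_n T^n (f (p_n)): the operator T of
   W is substituted for the variable, and f is applied to the coefficients. *)
Definition subst_var (W : zmodType) (f : M -> W) (T : W -> W)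
    (p : {malg M[nat]}) : W :=
  \sum_(n <- msupp p) iter n T (f p@_n).

End PolynomialsWithModuleCoefficients.

Section LieConformalAlgebra.

Variables (k : fieldType) (M : lmodType {poly k}).

(* br a b stands for [a_lambda b]. *)
Implicit Type br : M -> M -> {malg M[nat]}.

(* A scalar c : k acts on M as the constant polynomial c%:P. *)
Definition bilinear_bracket br : Prop :=
  (forall (c : k) (a a' b : M),
     br (c%:P *: a + a') b = coef_scale c%:P (br a b) + br a' b) /\
  (forall (c : k) (a b b' : M),
     br a (c%:P *: b + b') = coef_scale c%:P (br a b) + br a b').

Definition conformal_sesquilinear br : Prop :=
  (forall a b : M, br ('X *: a) b = - mul_lambda (br a b)) /\
  (forall a b : M,
     br a ('X *: b) = coef_partial (br a b) + mul_lambda (br a b)).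

Definition skew_symmetric br : Prop :=
  forall a b : M,
    br b a =
    - subst_var (fun v => << v *g 0%N >>)
                (fun p => - coef_partial p - mul_lambda p) (br a b).

(* [a_T b] in M[lambda, mu], for an operator T on M[lambda, mu]. *)
Definition bracket_at br (T : poly2 M -> poly2 M)
    (a b : M) : poly2 M :=
  subst_var (fun v => << v *g (0%N, 0%N) >>) T (br a b).

Definition jacobi_identity br : Prop :=
  let lambda := @mul_lambda2 k M in
  let mu := @mul_mu2 k M in
  forall a b c : M,
    subst_var (fun d => bracket_at br (fun p => lambda p + mu p) d c)
              lambda (br a b) =
    subst_var (fun d => bracket_at br lambda a d) mu (br b c) -
    subst_var (fun d => bracket_at br mu b d) lambda (br a c).

Record lie_conformal_bracket br : Prop := {
  lie_conformal_bilinear : bilinear_bracket br;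
  lie_conformal_sesquilinear : conformal_sesquilinear br;
  lie_conformal_skew : skew_symmetric br;
  lie_conformal_jacobi : jacobi_identity br
}.

End LieConformalAlgebra.

Section BlockBracket.

Variable k : fieldType.

(* The free k[partial]-module with basis indexed by int. *)
Definition blockB : lmodType {poly k} := {malg {poly k}[int]}.

Definition blockL (alpha : int) : blockB := << alpha >>.

(* (alpha partial + (alpha + beta) lambda) L_(alpha + beta), sorted by powers
   of lambda. *)
Definition block_basis_bracket (alpha beta : int) : {malg blockB[nat]} :=
  << (alpha%:~R *: 'X) *: blockL (alpha + beta) *g 0%N >> +
  << ((alpha + beta)%:~R)%:P *: blockL (alpha + beta) *g 1%N >>.

Definition extends_block_bracket
    (br : blockB -> blockB -> {malg blockB[nat]}) : Prop :=
  [/\ bilinear_bracket br,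
      conformal_sesquilinear br &
      forall alpha beta : int,
        br (blockL alpha) (blockL beta) = block_basis_bracket alpha beta].

End BlockBracket.

(* Main.v *)
(* The extension is forced to be
   [p(partial) L_alpha _lambda q(partial) L_beta] =
     p(-lambda) q(partial + lambda) [L_alpha _lambda L_beta].
   In each argument, the two sides of skew symmetry are k-linear and turn the
   action of partial into the same operator, and so do the two sides of the
   Jacobi identity (the operators being -lambda, -mu and partial + lambda + mu
   for its three arguments).  Hence both identities, like uniqueness, need only
   be verified on basis vectors, where they are polynomial identities. *)

Require Import Defs.
From mathcomp Require Import all_boot all_order all_algebra.
From mathcomp Require Import finmap monalg.
From mathcomp.real_closed Require Import complex.
From mathcomp Require Import reals.
From mathcomp Require Import boolp ring.

Set Implicit Arguments.
Unset Strict Implicit.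
Unset Printing Implicit Defensive.

Import GRing.Theory.
Local Open Scope ring_scope.

Notation add_morph f := {morph f : x y / x + y}.

(** * Additive maps between abelian groups, with additivity as a bare predicate on functions *)

Section AdditiveMaps.

Variables (V W : zmodType) (f : V -> W).
Hypothesis fD : add_morph f.

Lemma add_morph0 : f 0 = 0.
Proof. by apply: (addrI (f 0)); rewrite -fD !addr0. Qed.

Lemma add_morphN : {morph f : x / - x}.
Proof. by move=> x; apply: (addrI (f x)); rewrite -fD !subrr add_morph0. Qed.

Lemma add_morphB : {morph f : x y / x - y}.
Proof. by move=> x y; rewrite fD add_morphN. Qed.

Lemma add_morph_sum (I : Type) (r : seq I) (F : I -> V) :
  f (\sum_(i <- r) F i) = \sum_(i <- r) f (F i).
Proof. exact: (big_morph f fD add_morph0). Qed.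

Lemma add_morphMz (n : int) : {morph f : x / x *~ n}.
Proof.
have fMn m : {morph f : x / x *+ m}.
  move=> x; elim: m => [|m IH]; first by rewrite !mulr0n add_morph0.
  by rewrite !mulrS fD IH.
by move=> x; case: n => m; rewrite ?NegzE ?mulrNz ?add_morphN fMn.
Qed.

Lemma add_morph_opp : add_morph (fun x => - f x).
Proof. by move=> x y; rewrite fD opprD. Qed.

Lemma add_morph_add (g : V -> W) :
  add_morph g -> add_morph (fun x => f x + g x).
Proof. by move=> gD x y; rewrite fD gD addrACA. Qed.

End AdditiveMaps.

Lemma iter_add_morph (V : zmodType) (T : V -> V) n :
  add_morph T -> add_morph (iter n T).
Proof. by move=> TD x y; elim: n => //= n ->; apply: TD. Qed.

Lemma iter_commute (A : Type) (g T : A -> A) n x :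
  (forall y, g (T y) = T (g y)) -> g (iter n T x) = iter n T (g x).
Proof. by move=> gT; elim: n => //= n <-. Qed.

(** * Sums over the support of a finitely supported family *)

Section FinitelySupportedFamilies.

Variables (K : choiceType) (M W : zmodType).
Implicit Types p q : {malg M[K]}.

Lemma malg_ext (f g : {malg M[K]} -> W) :
  add_morph f -> add_morph g ->
  (forall v e, f << v *g e >> = g << v *g e >>) -> f =1 g.
Proof.
move=> fD gD fg p; rewrite (monalgE p) !add_morph_sum //.
by apply: eq_bigr => e _.
Qed.

Variable F : K -> M -> W.
Hypothesis FD : forall e, add_morph (F e).

(** The added terms vanish since each [F e] is additive. This brings sums over the supports of [p],
    [q] and [p + q] to one common index set. *)
Lemma msum_widen p (A : {fset K}) : (msupp p `<=` A)%fset ->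
  \sum_(e <- msupp p) F e p@_e = \sum_(e <- A) F e p@_e.
Proof.
move=> sub; rewrite (big_fset_incl _ sub) // => e _ /mcoeff_outdom ->.
exact: add_morph0.
Qed.

Lemma msumD : add_morph (fun p => \sum_(e <- msupp p) F e p@_e).
Proof.
move=> p q /=.
rewrite (msum_widen (msuppD_le p q)) (msum_widen (fsubsetUl _ (msupp q))).
rewrite (msum_widen (fsubsetUr (msupp p) _)) -big_split.
by apply: eq_bigr => e _; rewrite mcoeffD FD.
Qed.

Lemma msumU v e :
  \sum_(e' <- msupp << v *g e >>) F e' << v *g e >>@_e' = F e v.
Proof. by rewrite (msum_widen msuppU_le) big_seq_fset1 mcoeffUU. Qed.

End FinitelySupportedFamilies.

(** * Operators on polynomials with module coefficients, and substitution for the variable *)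

Section CoefficientOperators.

Variables (k : fieldType) (M : lmodType {poly k}).

(** The same formula as [coef_scale], but for any exponents, so that it also acts on
    M[lambda, mu]. *)
Definition mscale (K : choiceType) (q : {poly k}) (p : {malg M[K]}) :
    {malg M[K]} :=
  \sum_(e <- msupp p) << q *: p@_e *g e >>.

(** Common form of [mul_lambda], [mul_lambda2] and [mul_mu2], which are instances of it by
    conversion and inherit its properties. *)
Definition reindex (K K' : choiceType) (h : K -> K') (p : {malg M[K]}) :
    {malg M[K']} :=
  \sum_(e <- msupp p) << p@_e *g h e >>.

Lemma mscaleD (K : choiceType) q : add_morph (@mscale K q).
Proof.
by apply: (msumD (F := fun e v => << q *: v *g e >>)) => e x y;
  rewrite scalerDr monalgUD.
Qed.

Lemma mscaleU (K : choiceType) q v (e : K) :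
  mscale q << v *g e >> = << q *: v *g e >>.
Proof.
by apply: (msumU (F := fun e v => << q *: v *g e >>)) => ? x y;
  rewrite scalerDr monalgUD.
Qed.

Lemma reindexD (K K' : choiceType) (h : K -> K') : add_morph (reindex h).
Proof.
by apply: (msumD (F := fun e v => << v *g h e >>)) => e x y;
  rewrite monalgUD.
Qed.

Lemma reindexU (K K' : choiceType) (h : K -> K') v e :
  reindex h << v *g e >> = << v *g h e >>.
Proof.
by apply: (msumU (F := fun e v => << v *g h e >>)) => ? x y;
  rewrite monalgUD.
Qed.

Lemma mscaleC (K : choiceType) q q' (p : {malg M[K]}) :
  mscale q (mscale q' p) = mscale q' (mscale q p).
Proof.
move: p; apply: malg_ext => [x y|x y|v e]; rewrite ?mscaleD //.
by rewrite !mscaleU !scalerA mulrC.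
Qed.

Lemma mscale_reindex (K K' : choiceType) (h : K -> K') q p :
  mscale q (reindex h p) = reindex h (mscale q p).
Proof.
move: p; apply: malg_ext => [x y|x y|v e].
- by rewrite reindexD mscaleD.
- by rewrite mscaleD reindexD.
- by rewrite reindexU !mscaleU reindexU.
Qed.

Lemma mul_lambda2_mu2 (p : poly2 M) :
  mul_lambda2 (mul_mu2 p) = mul_mu2 (mul_lambda2 p).
Proof.
have lD : add_morph (@mul_lambda2 k M) by apply: reindexD.
have mD : add_morph (@mul_mu2 k M) by apply: reindexD.
have lU v e : mul_lambda2 << v *g e >> = << v *g (e.1.+1, e.2) >> :> poly2 M
  by apply: reindexU.
have mU v e : mul_mu2 << v *g e >> = << v *g (e.1, e.2.+1) >> :> poly2 M
  by apply: reindexU.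
move: p; apply: malg_ext => [x y|x y|v e].
- by rewrite mD lD.
- by rewrite lD mD.
- by rewrite !(lU, mU).
Qed.

Section SubstVar.

Variables (W : zmodType) (T : W -> W).
Hypothesis TD : add_morph T.
Implicit Types (f : M -> W) (p : {malg M[nat]}).

Lemma subst_varD f : add_morph f -> add_morph (subst_var f T).
Proof.
move=> fD; apply: (msumD (F := fun n v => iter n T (f v))) => n x y.
by rewrite fD; apply: iter_add_morph.
Qed.

Lemma subst_varU f v n : add_morph f ->
  subst_var f T << v *g n >> = iter n T (f v).
Proof.
move=> fD; apply: (msumU (F := fun n v => iter n T (f v))) => e x y.
by rewrite fD; apply: iter_add_morph.
Qed.

(** Multiplying by the variable raises every exponent by one, which costs one more iterate of
    [T]. *)
Lemma subst_var_lambda f p : add_morph f ->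
  subst_var f T (mul_lambda p) = T (subst_var f T p).
Proof.
move=> fD; have lD : add_morph (@mul_lambda k M) by apply: reindexD.
move: p; apply: malg_ext => [x y|x y|v n].
- by rewrite lD subst_varD.
- by rewrite subst_varD // TD.
- by rewrite [mul_lambda _]reindexU !subst_varU.
Qed.

Lemma subst_var_comp f (g : W -> W) p :
  add_morph g -> (forall w, g (T w) = T (g w)) ->
  subst_var (g \o f) T p = g (subst_var f T p).
Proof.
move=> gD gT; rewrite /subst_var add_morph_sum //.
by apply: eq_bigr => n _; rewrite iter_commute.
Qed.

Lemma subst_var_add f g p :
  subst_var (fun d => f d + g d) T p = subst_var f T p + subst_var g T p.
Proof.
rewrite /subst_var -big_split; apply: eq_bigr => n _.
exact: iter_add_morph.
Qed.

Lemma subst_var_scale f (g : W -> W) q p :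
  add_morph f -> add_morph g -> (forall w, g (T w) = T (g w)) ->
  (forall v, f (q *: v) = g (f v)) ->
  subst_var f T (coef_scale q p) = g (subst_var f T p).
Proof.
move=> fD gD gT fg; move: p; apply: malg_ext => [x y|x y|v n].
- by rewrite [coef_scale _ _]mscaleD subst_varD.
- by rewrite subst_varD.
- by rewrite [coef_scale _ _]mscaleU !subst_varU // fg iter_commute.
Qed.

End SubstVar.

End CoefficientOperators.

(** * Semilinear maps and their stability under substitution *)

Section Semilinear.

Variables (k : fieldType) (M : lmodType {poly k}).

(* k-linear maps that turn the action of partial into the operator D. *)
Definition semilinear (K : choiceType) (D : {malg M[K]} -> {malg M[K]})
    (f : M -> {malg M[K]}) : Prop :=
  (forall (c : k) a b, f (c%:P *: a + b) = mscale c%:P (f a) + f b) /\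
  (forall a, f ('X *: a) = D (f a)).

Lemma mscale1 (K : choiceType) (p : {malg M[K]}) : mscale 1 p = p.
Proof.
move: p; apply: malg_ext => [x y|x y|v e]; rewrite ?mscaleD //.
by rewrite mscaleU scale1r.
Qed.

Section SemilinearTheory.

Variables (K : choiceType) (D : {malg M[K]} -> {malg M[K]}).
Hypothesis DD : add_morph D.
Implicit Type f : M -> {malg M[K]}.

Lemma semilinearD f : semilinear D f -> add_morph f.
Proof. by case=> fl _ x y; rewrite -{1}[x]scale1r -polyC1 fl polyC1 mscale1. Qed.

Lemma semilinearZ f (c : k) a :
  semilinear D f -> f (c%:P *: a) = mscale c%:P (f a).
Proof.
by move=> fs; rewrite -[c%:P *: a]addr0 fs.1 (add_morph0 (semilinearD fs)) addr0.
Qed.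

Lemma semilinearN f : semilinear D f -> semilinear D (fun a => - f a).
Proof.
case=> fl fX; split=> [c a b|a]; last by rewrite fX (add_morphN DD).
by rewrite fl opprD (add_morphN (mscaleD _)).
Qed.

Lemma semilinearB f g :
  semilinear D f -> semilinear D g -> semilinear D (fun a => f a - g a).
Proof.
case=> fl fX [gl gX]; split=> [c a b|a]; last by rewrite fX gX (add_morphB DD).
by rewrite fl gl (add_morphB (mscaleD _)) opprD addrACA.
Qed.

Lemma semilinear_eq (D' : {malg M[K]} -> {malg M[K]}) f :
  D =1 D' -> semilinear D f -> semilinear D' f.
Proof. by move=> DE [fl fX]; split=> // a; rewrite fX DE. Qed.

End SemilinearTheory.

Lemma semilinear_monomial (K : choiceType) (e : K) :
  semilinear (mscale 'X) (fun v : M => << v *g e >>).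
Proof. by split=> [c a b|a]; rewrite mscaleU // monalgUD. Qed.

Section Substitution.

Variables (K : choiceType) (T : {malg M[K]} -> {malg M[K]}).
Hypotheses (TD : add_morph T) (TZ : forall q p, mscale q (T p) = T (mscale q p)).

Section InBracket.

Variables (D : {malg M[K]} -> {malg M[K]}) (f : M -> {malg M[K]}).
Hypotheses (DD : add_morph D) (DT : forall w, D (T w) = T (D w)).
Hypothesis fs : semilinear D f.

Let fD : add_morph f := semilinearD fs.

Lemma subst_var_polyC (c : k) p :
  subst_var f T (coef_scale c%:P p) = mscale c%:P (subst_var f T p).
Proof.
apply: subst_var_scale => // [|w|v]; [exact: mscaleD | exact: TZ |].
exact: (semilinearZ c v fs).
Qed.

Lemma subst_var_partial p :
  subst_var f T (coef_partial p) = D (subst_var f T p).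
Proof. by apply: subst_var_scale => // v; apply: fs.2. Qed.

(** Substitution turns multiplication by lambda into [T], so the rule -lambda for a left argument
    becomes -[T]. *)
Lemma semilinear_subst_left h :
  semilinear (fun p => - mul_lambda p) h ->
  semilinear (fun w => - T w) (fun a => subst_var f T (h a)).
Proof.
have sD := subst_varD TD fD.
case=> hl hX; split=> [c a b|a].
  by rewrite hl sD [mscale _ _]/(coef_scale _ _) subst_var_polyC.
by rewrite hX (add_morphN sD) subst_var_lambda.
Qed.

(** Here partial acts on the coefficients, where [f] turns it into [D], while lambda becomes [T];
    the rule partial + lambda thus becomes [D] + [T]. *)
Lemma semilinear_subst_right h :
  semilinear (fun p => coef_partial p + mul_lambda p) h ->
  semilinear (fun w => D w + T w) (fun a => subst_var f T (h a)).
Proof.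
have sD := subst_varD TD fD.
case=> hl hX; split=> [c a b|a].
  by rewrite hl sD [mscale _ _]/(coef_scale _ _) subst_var_polyC.
by rewrite hX sD subst_var_partial subst_var_lambda.
Qed.

End InBracket.

(** Handles an argument that enters through [f] and not through the polynomial [p]. Each coefficient
    of [p] then contributes [E] under some iterate of [T], and commutation lets [E] be pulled out of
    the sum. *)
Lemma semilinear_subst_param (E : {malg M[K]} -> {malg M[K]})
    (f : M -> M -> {malg M[K]}) p :
  add_morph E -> (forall w, E (T w) = T (E w)) ->
  (forall d, semilinear E (f^~ d)) ->
  semilinear E (fun a => subst_var (f a) T p).
Proof.
move=> ED ET fs; split=> [c a b|a].
  rewrite -(subst_var_comp (f a) p (@mscaleD _ M K c%:P) (TZ _)).
  rewrite -(subst_var_add TD); congr (subst_var _ T p).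
  by apply: funext => d; apply: (fs d).1.
rewrite -(subst_var_comp (f a) p ED ET); congr (subst_var _ T p).
by apply: funext => d; apply: (fs d).2.
Qed.

End Substitution.

End Semilinear.

(** * Semilinearity of both sides of skew symmetry and of the Jacobi identity *)

Section Brackets.

Variables (k : fieldType) (M : lmodType {poly k}).
Variable br : M -> M -> {malg M[nat]}.
Hypotheses (br_bilin : bilinear_bracket br)
  (br_sesqui : conformal_sesquilinear br).

Local Notation lambda := (@mul_lambda2 k M).
Local Notation mu := (@mul_mu2 k M).
Local Notation partial := (@mscale k M (nat * nat)%type 'X).
Local Notation lam := (@mul_lambda k M).

Let lamD : add_morph lam := @reindexD _ _ _ _ _.
Let lambdaD : add_morph lambda := @reindexD _ _ _ _ _.
Let muD : add_morph mu := @reindexD _ _ _ _ _.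
Let lamZ q p : mscale q (lam p) = lam (mscale q p).
Proof. exact: mscale_reindex. Qed.
Let lambdaZ q p : mscale q (lambda p) = lambda (mscale q p).
Proof. exact: mscale_reindex. Qed.
Let muZ q p : mscale q (mu p) = mu (mscale q p).
Proof. exact: mscale_reindex. Qed.

Lemma bracket_semilinear_left b :
  semilinear (fun p => - mul_lambda p) (br^~ b).
Proof. by split=> [c x y|x]; [apply: br_bilin.1 | apply: br_sesqui.1]. Qed.

Lemma bracket_semilinear_right a :
  semilinear (fun p => coef_partial p + mul_lambda p) (br a).
Proof. by split=> [c x y|x]; [apply: br_bilin.2 | apply: br_sesqui.2]. Qed.

Definition skew_image (p : {malg M[nat]}) : {malg M[nat]} :=
  subst_var (fun v => << v *g 0%N >>)
            (fun p => - coef_partial p - mul_lambda p) p.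

Let skewT (p : {malg M[nat]}) := - coef_partial p - mul_lambda p.

Let skewTD : add_morph skewT.
Proof.
exact: (add_morph_add (add_morph_opp (@mscaleD _ _ _ _)) (add_morph_opp lamD)).
Qed.

Let skewTZ q p : mscale q (skewT p) = skewT (mscale q p).
Proof.
rewrite /skewT (add_morphB (mscaleD _)) (add_morphN (mscaleD _)) lamZ.
by rewrite [mscale q (coef_partial p)]mscaleC.
Qed.

(** Replacing lambda by -partial - lambda turns -lambda into partial + lambda, which is the rule for
    the right argument of [br]. *)
Lemma skew_semilinear_left b :
  semilinear (fun p => coef_partial p + mul_lambda p)
             (fun a => - skew_image (br a b)).
Proof.
apply: (@semilinear_eq _ _ _ (fun p => - skewT p)) => [p|].
  by rewrite /skewT opprB opprK addrC.
apply: semilinearN; first exact: add_morph_opp.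
exact: (semilinear_subst_left skewTD skewTZ (semilinear_monomial M 0%N)
          (bracket_semilinear_left b)).
Qed.

(** The rule partial + lambda becomes partial + (-partial - lambda) = -lambda. *)
Lemma skew_semilinear_right a :
  semilinear (fun p => - mul_lambda p) (fun b => - skew_image (br a b)).
Proof.
apply: (@semilinear_eq _ _ _ (fun p => mscale 'X p + skewT p)) => [p|].
  by rewrite /skewT addrA [coef_partial p]/(mscale _ _) subrr add0r.
apply: semilinearN; first exact: (add_morph_add (mscaleD _) skewTD).
exact: (semilinear_subst_right skewTD skewTZ (mscaleD _) (skewTZ _)
          (semilinear_monomial M 0%N) (bracket_semilinear_right a)).
Qed.

Section BracketAt.

Variable T : poly2 M -> poly2 M.
Hypotheses (TD : add_morph T) (TZ : forall q p, mscale q (T p) = T (mscale q p)).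

Lemma bracket_at_semilinear_left b :
  semilinear (fun p => - T p) (fun a => bracket_at br T a b).
Proof.
exact: (semilinear_subst_left TD TZ (semilinear_monomial M (0, 0)%N)
          (bracket_semilinear_left b)).
Qed.

Lemma bracket_at_semilinear_right a :
  semilinear (fun p => partial p + T p) (bracket_at br T a).
Proof.
exact: (semilinear_subst_right TD TZ (mscaleD _) (TZ _)
          (semilinear_monomial M (0, 0)%N) (bracket_semilinear_right a)).
Qed.

End BracketAt.

Definition jacobi_left (a b c : M) : poly2 M :=
  subst_var (fun d => bracket_at br (fun p => lambda p + mu p) d c)
            lambda (br a b).

(* [a_T [b_U c]] *)
Definition jacobi_right (T U : poly2 M -> poly2 M) (a b c : M) : poly2 M :=
  subst_var (fun d => bracket_at br T a d) U (br b c).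

Let sumT (p : poly2 M) := lambda p + mu p.

Let sumTD : add_morph sumT.
Proof. exact: add_morph_add. Qed.

Let sumTZ q p : mscale q (sumT p) = sumT (mscale q p).
Proof. by rewrite /sumT mscaleD lambdaZ muZ. Qed.

Let sumT_lambda p : sumT (lambda p) = lambda (sumT p).
Proof. by rewrite /sumT lambdaD mul_lambda2_mu2. Qed.

Let jleft_inner c := bracket_at_semilinear_left sumTD sumTZ c.

Lemma jacobi_left_semilinear1 b c :
  semilinear (fun p => - lambda p) (fun a => jacobi_left a b c).
Proof.
exact: (semilinear_subst_left lambdaD lambdaZ (jleft_inner c)
          (bracket_semilinear_left b)).
Qed.

(** The outer bracket turns partial into -(lambda + mu), so the rule partial + lambda for [b] in
    [a_lambda b] yields -(lambda + mu) + lambda = -mu. *)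
Lemma jacobi_left_semilinear2 a c :
  semilinear (fun p => - mu p) (fun b => jacobi_left a b c).
Proof.
apply: (@semilinear_eq _ _ _ (fun p => - sumT p + lambda p)) => [p|].
  by rewrite /sumT opprD addrAC addNr add0r.
apply: (semilinear_subst_right lambdaD lambdaZ _ _ (jleft_inner c)
          (bracket_semilinear_right a)) => [|w].
- exact: add_morph_opp.
- by rewrite sumT_lambda (add_morphN lambdaD).
Qed.

Lemma jacobi_left_semilinear3 a b :
  semilinear (fun p => partial p + (lambda p + mu p)) (jacobi_left a b).
Proof.
apply: (semilinear_subst_param lambdaD lambdaZ) => [|w|d].
- exact: (add_morph_add (mscaleD _) sumTD).
- by rewrite -!/(sumT _) sumT_lambda lambdaZ lambdaD.
- exact: bracket_at_semilinear_right.
Qed.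

Section JacobiRight.

Variables T U : poly2 M -> poly2 M.
Hypotheses (TD : add_morph T) (TZ : forall q p, mscale q (T p) = T (mscale q p)).
Hypotheses (UD : add_morph U) (UZ : forall q p, mscale q (U p) = U (mscale q p)).
Hypothesis TU : forall p, T (U p) = U (T p).

Lemma jacobi_right_semilinear1 b c :
  semilinear (fun p => - T p) (fun a => jacobi_right T U a b c).
Proof.
apply: (semilinear_subst_param UD UZ) => [|w|d].
- exact: add_morph_opp.
- by rewrite TU (add_morphN UD).
- exact: bracket_at_semilinear_left.
Qed.

Lemma jacobi_right_semilinear2 a c :
  semilinear (fun p => - U p) (fun b => jacobi_right T U a b c).
Proof.
exact: (semilinear_subst_left UD UZ (bracket_at_semilinear_right TD TZ a)
          (bracket_semilinear_left c)).
Qed.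

Lemma jacobi_right_semilinear3 a b :
  semilinear (fun p => partial p + T p + U p) (jacobi_right T U a b).
Proof.
apply: (semilinear_subst_right UD UZ _ _ (bracket_at_semilinear_right TD TZ a)
          (bracket_semilinear_right b)) => [|w].
- exact: (add_morph_add (mscaleD _) TD).
- by rewrite UD UZ TU.
Qed.

End JacobiRight.

Definition jacobi_rhs (a b c : M) : poly2 M :=
  jacobi_right lambda mu a b c - jacobi_right mu lambda b a c.

Let mu_lambda p : mu (lambda p) = lambda (mu p).
Proof. by rewrite mul_lambda2_mu2. Qed.

(** In the subtracted term [a] is the left argument of the inner bracket, so there the rule for the
    second argument applies, with lambda and mu exchanged. *)
Lemma jacobi_rhs_semilinear1 b c :
  semilinear (fun p => - lambda p) (fun a => jacobi_rhs a b c).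
Proof.
apply: semilinearB; first exact: add_morph_opp.
- exact: (jacobi_right_semilinear1 lambdaD lambdaZ muD muZ (@mul_lambda2_mu2 _ _)).
- exact: (jacobi_right_semilinear2 muD muZ lambdaD lambdaZ).
Qed.

Lemma jacobi_rhs_semilinear2 a c :
  semilinear (fun p => - mu p) (fun b => jacobi_rhs a b c).
Proof.
apply: semilinearB; first exact: add_morph_opp.
- exact: (jacobi_right_semilinear2 lambdaD lambdaZ muD muZ).
- exact: (jacobi_right_semilinear1 muD muZ lambdaD lambdaZ mu_lambda).
Qed.

Lemma jacobi_rhs_semilinear3 a b :
  semilinear (fun p => partial p + (lambda p + mu p)) (jacobi_rhs a b).
Proof.
apply: semilinearB.
- exact: (add_morph_add (mscaleD _) sumTD).
- apply: semilinear_eq (jacobi_right_semilinear3 lambdaD lambdaZ muD muZ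
    (@mul_lambda2_mu2 _ _) a b) => p.
  by rewrite addrA.
- apply: semilinear_eq (jacobi_right_semilinear3 muD muZ lambdaD lambdaZ
    mu_lambda b a) => p.
  by rewrite addrA addrAC.
Qed.

End Brackets.

(* The Jacobi identity on basis vectors, with v = L_(alpha + beta + gamma) and
   P, X, Y standing for partial, lambda, mu.  The jointly injective additive
   maps h i (later, the coefficients) carry it to a commutative ring. *)
Lemma commuting_jacobi (V : zmodType) (I : Type) (R : comRingType)
    (h : I -> V -> R) (P X Y : V -> V) (v : V) (a b c : int) :
  (forall i, add_morph (h i)) ->
  (forall x y, (forall i, h i x = h i y) -> x = y) ->
  add_morph P -> add_morph X -> add_morph Y ->
  (forall w, P (X w) = X (P w)) -> (forall w, P (Y w) = Y (P w)) ->
  (forall w, X (Y w) = Y (X w)) ->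
  - (X (P v *~ (a + b) + (X v + Y v) *~ (a + b + c)) +
     Y (P v *~ (a + b) + (X v + Y v) *~ (a + b + c))) *~ a +
  X (P v *~ (a + b) + (X v + Y v) *~ (a + b + c)) *~ (a + b) =
  (P (P v *~ a + X v *~ (a + b + c)) + X (P v *~ a + X v *~ (a + b + c))) *~ b +
  Y (P v *~ a + X v *~ (a + b + c)) *~ (b + c) -
  ((P (P v *~ b + Y v *~ (a + b + c)) + Y (P v *~ b + Y v *~ (a + b + c))) *~ a +
   X (P v *~ b + Y v *~ (a + b + c)) *~ (a + c)).
Proof.
move=> hD hinj PD XD YD PX PY XY; apply: hinj => i.
rewrite !(PD, XD, YD, add_morphMz PD, add_morphMz XD, add_morphMz YD).
(* Words in the commuting operators are put in a normal order, so that equal monomials applied to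
   [v] become identical atoms for [ring]. *)
rewrite !PX !PY XY.
do 4 rewrite ?(hD i, add_morphN (hD i), add_morphMz (hD i)).
ring.
Qed.

(** * The free module [blockB]: reduction to basis vectors *)

Section Block.

Variable k : fieldType.
Local Notation B := (blockB k).
Local Notation L := (blockL k).

Lemma scale_monomial (q p : {poly k}) (alpha : int) :
  q *: (<< p *g alpha >> : B) = << q * p *g alpha >>.
Proof. by apply/malgP => e; rewrite mcoeffZ !mcoeffU mulrnAr. Qed.

(** A polynomial in partial is built by multiplying by partial and adding constants. Since [f] and
    [g] share the operator [D], agreement on L_alpha propagates to every multiple p L_alpha, then to
    sums. *)
Lemma blockB_ext (K : choiceType) (D : {malg B[K]} -> {malg B[K]})
    (f g : B -> {malg B[K]}) :
  semilinear D f -> semilinear D g ->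
  (forall alpha, f (L alpha) = g (L alpha)) -> f =1 g.
Proof.
move=> fs gs fg; have fD := semilinearD fs; have gD := semilinearD gs.
apply: malg_ext => // p alpha; elim/poly_ind: p => [|p c IH].
  by rewrite monalgU0 (add_morph0 fD) (add_morph0 gD).
rewrite monalgUD fD gD mulrC -scale_monomial fs.2 gs.2 IH.
congr (_ + _); rewrite -[c%:P]mulr1 -scale_monomial.
by rewrite (semilinearZ _ _ fs) (semilinearZ _ _ gs) fg.
Qed.

Lemma scale_intC (V : lmodType {poly k}) (n : int) (w : V) :
  (n%:~R : k)%:P *: w = w *~ n.
Proof. by rewrite -scaler_int rmorph_int. Qed.

Lemma block_basis_bracketE (alpha beta : int) :
  block_basis_bracket k alpha beta =
  << 'X *: L (alpha + beta) *g 0%N >> *~ alpha +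
  << L (alpha + beta) *g 1%N >> *~ (alpha + beta).
Proof.
rewrite /block_basis_bracket -mul_polyC -scalerA !scale_intC.
by rewrite !(add_morphMz (monalgUD _)).
Qed.

(** * Existence of the extension, by an explicit formula *)

Section Existence.

(** The product P(partial, lambda) v. It moves the checks of the bracket rules into the commutative
    ring k[partial][lambda]. *)
Definition emb (v : B) (P : {poly {poly k}}) : {malg B[nat]} :=
  \sum_(n < size P) << P`_n *: v *g n : nat >>.

Lemma embE v P n : (emb v P)@_n = P`_n *: v.
Proof.
rewrite /emb raddf_sum /=; under eq_bigr => i _ do rewrite mcoeffU.
case: (ltnP n (size P)) => [ltn|/(nth_default 0) Pn0].
  rewrite (bigD1 (Ordinal ltn)) //= eqxx big1 ?addr0 // => i.
  by rewrite -val_eqE /= => /negPf ->.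
rewrite Pn0 scale0r big1 // => i _; case: eqP => // ein.
by rewrite ein Pn0 scale0r.
Qed.

Lemma embD v : add_morph (emb v).
Proof. by move=> P Q; apply/malgP => n; rewrite mcoeffD !embE coefD scalerDl. Qed.

Lemma coef_scaleE (M : lmodType {poly k}) q (p : {malg M[nat]}) n :
  (coef_scale q p)@_n = q *: p@_n.
Proof.
move: p; apply: (malg_ext (f := fun p => (coef_scale q p)@_n)) => [x y|x y|v m].
- by rewrite [coef_scale _ _]mscaleD mcoeffD.
- by rewrite mcoeffD scalerDr.
- by rewrite [coef_scale _ _]mscaleU !mcoeffU scalerMnr.
Qed.

Lemma embZ v q P : emb v (q%:P * P) = coef_scale q (emb v P).
Proof. by apply/malgP => n; rewrite coef_scaleE !embE coefCM scalerA. Qed.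

Lemma mul_lambdaE (M : lmodType {poly k}) (p : {malg M[nat]}) n :
  (mul_lambda p)@_n = if n is m.+1 then p@_m else 0.
Proof.
have lD : add_morph (@mul_lambda k M) by apply: reindexD.
move: p; apply: (malg_ext (f := fun p => (mul_lambda p)@_n)) => [x y|x y|v m].
- by rewrite lD mcoeffD.
- by case: n => [|n]; rewrite ?addr0 ?mcoeffD.
- by rewrite [mul_lambda _]reindexU; case: n => [|n]; rewrite !mcoeffU.
Qed.

Lemma embX v P : emb v ('X * P) = mul_lambda (emb v P).
Proof.
apply/malgP => n; rewrite mul_lambdaE embE coefXM.
by case: n => [|n]; rewrite ?scale0r ?embE.
Qed.

Lemma block_basis_bracket_emb (alpha beta : int) :
  block_basis_bracket k alpha beta =
  emb (L (alpha + beta))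
      ((alpha%:~R *: 'X)%:P + ((alpha + beta)%:~R)%:P%:P * 'X).
Proof.
apply/malgP => n; rewrite mcoeffD !mcoeffU embE coefD coefC coefCM coefX.
by case: n => [|[|n]]; rewrite ?mulr0 ?mulr1 ?addr0 ?add0r ?scale0r ?mulr0n.
Qed.

(** [p^:P] reads p as a polynomial in the outer variable with constant coefficients; composition
    then gives p(-lambda), and below q(lambda + partial), where ['X%:P] is partial. *)
Definition left_factor (p : {poly k}) : {poly {poly k}} := p^:P \Po - 'X.
Definition right_factor (q : {poly k}) : {poly {poly k}} :=
  q^:P \Po ('X + 'X%:P).

(* [p(partial) L_alpha _lambda q(partial) L_beta] is
   p(-lambda) q(partial + lambda) [L_alpha _lambda L_beta]; the outer variable
   of {poly {poly k}} is lambda and the inner one is partial. *)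
Definition block_monomial_bracket (alpha beta : int) (p q : {poly k}) :=
  emb (L (alpha + beta)) (left_factor p * right_factor q *
      ((alpha%:~R *: 'X)%:P + ((alpha + beta)%:~R)%:P%:P * 'X)).

Definition block_bracket (a b : B) : {malg B[nat]} :=
  \sum_(alpha <- msupp a) \sum_(beta <- msupp b)
     block_monomial_bracket alpha beta a@_alpha b@_beta.

Lemma block_monomial_bracketDl alpha beta q :
  add_morph (block_monomial_bracket alpha beta ^~ q).
Proof.
move=> x y; rewrite /block_monomial_bracket -embD -!mulrDl.
by rewrite /left_factor !rmorphD.
Qed.

Lemma block_monomial_bracketDr alpha beta p :
  add_morph (block_monomial_bracket alpha beta p).
Proof.
move=> x y; rewrite /block_monomial_bracket -embD -!mulrDl -mulrDr.
by rewrite /right_factor !rmorphD.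
Qed.

Let inner_sum (b : B) alpha p :=
  \sum_(beta <- msupp b) block_monomial_bracket alpha beta p b@_beta.

Let inner_sumD b alpha : add_morph (inner_sum b alpha).
Proof.
move=> x y; rewrite /inner_sum -big_split; apply: eq_bigr => beta _.
exact: block_monomial_bracketDl.
Qed.

Lemma block_bracketDl b : add_morph (block_bracket^~ b).
Proof. exact: (msumD (inner_sumD b)). Qed.

Lemma block_bracketDr a : add_morph (block_bracket a).
Proof.
move=> x y; rewrite /block_bracket -big_split; apply: eq_bigr => alpha _.
exact: (msumD (fun beta => block_monomial_bracketDr alpha beta a@_alpha)).
Qed.

Lemma block_bracketU alpha beta p q :
  block_bracket << p *g alpha >> << q *g beta >> =
  block_monomial_bracket alpha beta p q.
Proof.
rewrite [LHS](msumU (inner_sumD << q *g beta >>)).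
exact: (msumU (fun e => block_monomial_bracketDr alpha e p)).
Qed.

(** Uses additivity alone and hence tests all monomials p L_alpha: the semilinearity needed for
    [blockB_ext] is what is still to be proved for [block_bracket]. *)
Lemma block_bracket_ext (X Y : B -> B -> {malg B[nat]}) :
  (forall b, add_morph (X^~ b)) -> (forall a, add_morph (X a)) ->
  (forall b, add_morph (Y^~ b)) -> (forall a, add_morph (Y a)) ->
  (forall alpha beta p q, X << p *g alpha >> << q *g beta >> =
                          Y << p *g alpha >> << q *g beta >>) ->
  forall a b, X a b = Y a b.
Proof.
move=> Xl Xr Yl Yr XY a b; move: a; apply: malg_ext => // p alpha.
by move: b; apply: malg_ext.
Qed.

(** Serves both constants, with [S] the coefficientwise scaling, and [q = 'X], with [S] equal to
    -lambda. The condition on [emb] is met because [left_factor] is multiplicative. *)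
Lemma block_bracket_scalel (q : {poly k}) (S : {malg B[nat]} -> {malg B[nat]}) :
  add_morph S ->
  (forall v p P, emb v (left_factor (q * p) * P) = S (emb v (left_factor p * P))) ->
  forall a b, block_bracket (q *: a) b = S (block_bracket a b).
Proof.
move=> SD Sq; apply: (block_bracket_ext (X := fun a b => block_bracket (q *: a) b)
  (Y := fun a b => S (block_bracket a b))) => [b x y|a x y|b x y|a x y|al be p r].
- by rewrite scalerDr block_bracketDl.
- by rewrite block_bracketDr.
- by rewrite block_bracketDl SD.
- by rewrite block_bracketDr SD.
- by rewrite scale_monomial !block_bracketU /block_monomial_bracket -!mulrA Sq.
Qed.

Lemma block_bracket_scaler (q : {poly k}) (S : {malg B[nat]} -> {malg B[nat]}) :
  add_morph S ->
  (forall v p P,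
     emb v (right_factor (q * p) * P) = S (emb v (right_factor p * P))) ->
  forall a b, block_bracket a (q *: b) = S (block_bracket a b).
Proof.
move=> SD Sq; apply: (block_bracket_ext (X := fun a b => block_bracket a (q *: b))
  (Y := fun a b => S (block_bracket a b))) => [b x y|a x y|b x y|a x y|al be p r].
- by rewrite block_bracketDl.
- by rewrite scalerDr block_bracketDr.
- by rewrite block_bracketDl SD.
- by rewrite block_bracketDr SD.
- rewrite scale_monomial !block_bracketU /block_monomial_bracket.
  by rewrite ![left_factor _ * _]mulrC -!mulrA Sq.
Qed.

Lemma block_bracket_extends : extends_block_bracket block_bracket.
Proof.
have sD q : add_morph (@coef_scale k B q) by apply: mscaleD.
have lD : add_morph (@mul_lambda k B) by apply: reindexD.
split.
- split=> [c a a' b|c a b b'].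
    rewrite block_bracketDl (block_bracket_scalel (sD c%:P)) // => v p P.
    by rewrite /left_factor rmorphM /= map_polyC comp_polyM comp_polyC -mulrA embZ.
  rewrite block_bracketDr (block_bracket_scaler (sD c%:P)) // => v p P.
  by rewrite /right_factor rmorphM /= map_polyC comp_polyM comp_polyC -mulrA embZ.
- split=> a b.
    apply: (block_bracket_scalel (S := fun p => - mul_lambda p)) => [|v p P].
      exact: add_morph_opp.
    rewrite /left_factor rmorphM /= map_polyX comp_polyM comp_polyX.
    by rewrite -mulrA mulNr (add_morphN (embD v)) embX.
  apply: (block_bracket_scaler (S := fun p => coef_partial p + mul_lambda p))
    => [|v p P].
    exact: (add_morph_add (sD _) lD).
  rewrite /right_factor rmorphM /= map_polyX comp_polyM comp_polyX.
  by rewrite -mulrA mulrDl embD embX embZ addrC.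
- move=> alpha beta; rewrite block_bracketU /block_monomial_bracket.
  rewrite block_basis_bracket_emb /left_factor /right_factor.
  by rewrite !rmorph1 !mul1r.
Qed.

End Existence.

(** Both brackets are semilinear in each argument for the same operators, so [blockB_ext], applied
    to one argument and then the other, leaves only the prescribed values. *)
Lemma extension_unique (br br' : B -> B -> {malg B[nat]}) :
  extends_block_bracket br -> extends_block_bracket br' -> br = br'.
Proof.
case=> bil sesq brL [bil' sesq' brL'].
apply: funext => a; apply: funext => b.
move: a; apply: blockB_ext (bracket_semilinear_left bil sesq b)
  (bracket_semilinear_left bil' sesq' b) _ => alpha.
move: b; apply: blockB_ext (bracket_semilinear_right bil sesq _)
  (bracket_semilinear_right bil' sesq' _) _ => beta.
by rewrite brL brL'.
Qed.

(** * Skew symmetry and the Jacobi identity for any extension *)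

Section LieConformal.

Variable br : B -> B -> {malg B[nat]}.
Hypothesis br_ext : extends_block_bracket br.

Let br_bilin : bilinear_bracket br. Proof. by case: br_ext. Qed.
Let br_sesqui : conformal_sesquilinear br. Proof. by case: br_ext. Qed.
Let brL alpha beta : br (L alpha) (L beta) = block_basis_bracket k alpha beta.
Proof. by case: br_ext. Qed.

Lemma extension_skew : skew_symmetric br.
Proof.
have sD q : add_morph (@coef_scale k B q) by apply: mscaleD.
have lD : add_morph (@mul_lambda k B) by apply: reindexD.
have TD : add_morph (fun p : {malg B[nat]} => - coef_partial p - mul_lambda p).
  exact: (add_morph_add (add_morph_opp (sD _)) (add_morph_opp lD)).
have oD : add_morph (fun v : B => << v *g 0%N >>) by apply: monalgUD.
have tD := subst_varD TD oD.
move=> a b.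
suff -> : br b a = - skew_image (br a b) by [].
move: a; apply: blockB_ext (bracket_semilinear_right br_bilin br_sesqui b)
  (skew_semilinear_left br_bilin br_sesqui b) _ => alpha.
move: b; apply: blockB_ext (bracket_semilinear_left br_bilin br_sesqui _)
  (skew_semilinear_right br_bilin br_sesqui _) _ => beta.
rewrite !brL !block_basis_bracketE /skew_image tD !(add_morphMz tD).
rewrite !subst_varU //= [coef_partial _]mscaleU [mul_lambda _]reindexU.
rewrite [beta + alpha]addrC.
(* With x = partial L and y = lambda L for L = L_(alpha + beta), the claim reads beta x + (alpha +
   beta) y = -(alpha x - (alpha + beta)(x + y)). *)
set x := << _ *g 0%N >>; set y := << _ *g 1%N >>.
rewrite -opprD mulNrz opprD opprK mulrzDl [x *~ (_ + _)]mulrzDr.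
by rewrite !addrA addNr add0r.
Qed.

(** Evaluates a nested bracket whose inner one is on basis vectors: in alpha partial + (alpha +
    beta) lambda, [f] turns partial into [D] and the substitution turns lambda into [T]. *)
Lemma subst_var_basis (f : B -> poly2 B) (T D : poly2 B -> poly2 B)
    (alpha beta : int) :
  add_morph T -> semilinear D f ->
  subst_var f T (br (L alpha) (L beta)) =
  D (f (L (alpha + beta))) *~ alpha + T (f (L (alpha + beta))) *~ (alpha + beta).
Proof.
move=> TD fs; have fD := semilinearD fs; have tD := subst_varD TD fD.
rewrite brL block_basis_bracketE tD !(add_morphMz tD) !(subst_varU TD _ _ fD).
by rewrite [iter _ _ _]/= [iter _ _ _]/= fs.2.
Qed.

Lemma bracket_at_basis (T : poly2 B -> poly2 B) (alpha beta : int) :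
  add_morph T ->
  bracket_at br T (L alpha) (L beta) =
  mscale 'X << L (alpha + beta) *g (0, 0)%N >> *~ alpha +
  T << L (alpha + beta) *g (0, 0)%N >> *~ (alpha + beta).
Proof. by move=> TD; apply: subst_var_basis => //; apply: semilinear_monomial. Qed.

Lemma extension_jacobi : jacobi_identity br.
Proof.
have lambdaD : add_morph (@mul_lambda2 k B) by apply: reindexD.
have muD : add_morph (@mul_mu2 k B) by apply: reindexD.
have partialD : add_morph (@mscale k B (nat * nat)%type 'X) by apply: mscaleD.
have lambdaZ q p : mscale q (mul_lambda2 p) = mul_lambda2 (mscale q p) :> poly2 B.
  exact: mscale_reindex.
have muZ q p : mscale q (mul_mu2 p) = mul_mu2 (mscale q p) :> poly2 B.
  exact: mscale_reindex.
have sumD : add_morph (fun p : poly2 B => mul_lambda2 p + mul_mu2 p).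
  exact: (add_morph_add lambdaD muD).
have sumZ q (p : poly2 B) :
    mscale q (mul_lambda2 p + mul_mu2 p) =
    mul_lambda2 (mscale q p) + mul_mu2 (mscale q p).
  by rewrite mscaleD lambdaZ muZ.
move=> /= a b c.
suff : jacobi_left br a b c = jacobi_rhs br a b c by [].
move: a; apply: blockB_ext (jacobi_left_semilinear1 br_bilin br_sesqui b c)
  (jacobi_rhs_semilinear1 br_bilin br_sesqui b c) _ => al.
move: b; apply: blockB_ext (jacobi_left_semilinear2 br_bilin br_sesqui _ c)
  (jacobi_rhs_semilinear2 br_bilin br_sesqui _ c) _ => be.
move: c; apply: blockB_ext (jacobi_left_semilinear3 br_bilin br_sesqui _ _)
  (jacobi_rhs_semilinear3 br_bilin br_sesqui _ _) _ => ga.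
rewrite /jacobi_left (subst_var_basis _ _ lambdaD
  (bracket_at_semilinear_left br_bilin br_sesqui sumD sumZ _)).
rewrite /jacobi_rhs /jacobi_right.
rewrite (subst_var_basis _ _ muD
  (bracket_at_semilinear_right br_bilin br_sesqui lambdaD lambdaZ _)).
rewrite (subst_var_basis _ _ lambdaD
  (bracket_at_semilinear_right br_bilin br_sesqui muD muZ _)).
rewrite (bracket_at_basis _ _ sumD) (bracket_at_basis _ _ lambdaD).
rewrite (bracket_at_basis _ _ muD).
(* All three nested brackets now involve the same basis vector, which is generalized to [v], and
   then the three operators, keeping only additivity and commutation. *)
have -> : be + (al + ga) = al + be + ga by rewrite addrCA addrA.
rewrite [al + (be + ga)]addrA.
move: << L _ *g _ >> => v.
have lmC := @mul_lambda2_mu2 k B.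
move: (@mul_lambda2 k B) (@mul_mu2 k B) (@mscale k B _ 'X) lmC partialD lambdaD muD
  (lambdaZ 'X) (muZ 'X) => X Y P XY PD XD YD PX PY.
(* The map indexed by ((m, n), s) extracts the coefficient in k[partial] of lambda^m mu^n L_s;
   together these coefficients determine an element. *)
apply: (commuting_jacobi (h := fun (i : (nat * nat) * int) (w : poly2 B) =>
  (w@_i.1 : B)@_i.2) v al be ga _ _ PD XD YD PX PY XY).
- by move=> i x y; rewrite !mcoeffD.
- by move=> x y xy; apply/malgP => e; apply/malgP => s; apply: (xy (e, s)).
Qed.

End LieConformal.
End Block.

(* The complex numbers are R[i], for R any model of the real numbers. *)
Theorem theorem1p1 (R : realType) :
  (exists! br : blockB R[i] -> blockB R[i] -> {malg (blockB R[i])[nat]},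
     extends_block_bracket br) /\
  (forall br : blockB R[i] -> blockB R[i] -> {malg (blockB R[i])[nat]},
     extends_block_bracket br -> lie_conformal_bracket br).
Proof.
split; last first.
  move=> br br_ext; case: (br_ext) => br_bilin br_sesqui _.
  by split=> //; [apply: extension_skew | apply: extension_jacobi].
exists (@block_bracket R[i]); split; first exact: block_bracket_extends.
by move=> br; apply: extension_unique; apply: block_bracket_extends.
Qed.
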